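(* In general, quantum-MV algebras are not (commutative) quantum-B algebras. That is, there exists a (left-)quantum-MV algebra $(X,\odot,{}^*,1)$ such that, with $x\to y:=(x\odot y^* )^*$ and $x\le y$ iff $x\to y=1$, the structure $(X,\le,\to)$ is not a commutative quantum-B algebra.
   Context: An involutive left-m-BE algebra is an algebra $(X,\odot,{}^*,1)$ of type $(2,1,0)$ such that, with $0:=1^*$, for all $x,y,z\in X$: $1\odot x=x=x\odot 1$; $x\odot y=y\odot x$; $x\odot(y\odot z)=(x\odot y)\odot z$; $x\odot 0=0$; $x\odot x^*=0$; $x^{**}=x$. In it put $x\wedge_m^M y:=(x^*\odot y)^*\odot y$ and $x\vee_m^M y:=(x^*\wedge_m^M y^* )^*$. A (left-)quantum-MV algebra is an involutive left-m-BE algebra satisfying $x\odot((x^*\vee_m^M y)\vee_m^M(z\vee_m^M x^* ))=(x\odot y)\vee_m^M(x\odot z)$ for all $x,y,z\in X$. A quantum-B algebra is a structure $(X,\le,\to,\rightsquigarrow)$ such that $(X,\le)$ is a partially ordered set and $\to,\rightsquigarrow$ are binary operations on $X$ satisfying, for all $x,y,z\in X$: $y\to z\le (x\to y)\to(x\to z)$; $y\rightsquigarrow z\le (x\rightsquigarrow y)\rightsquigarrow(x\rightsquigarrow z)$; $y\le z$ implies $x\to y\le x\to z$; $x\le y\to z$ iff $y\le x\rightsquigarrow z$. It is commutative if $x\to y=x\rightsquigarrow y$ for all $x,y$ (and is then written $(X,\le,\to)$). *)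

(* Defs.v *)
From Stdlib Require Import Relations.

Declare Scope mbe_scope.
Delimit Scope mbe_scope with mbe.

Record inv_left_mBE : Type := InvLeftMBE {
  carrier :> Type;
  prod : carrier -> carrier -> carrier;
  inv : carrier -> carrier;
  one : carrier;
  one_prod : forall x, prod one x = x;
  prod_one : forall x, prod x one = x;
  prod_comm : forall x y, prod x y = prod y x;
  prod_assoc : forall x y z, prod x (prod y z) = prod (prod x y) z;
  prod_zero : forall x, prod x (inv one) = inv one;
  prod_inv : forall x, prod x (inv x) = inv one;
  inv_inv : forall x, inv (inv x) = x
}.

Arguments prod {_} _ _.
Arguments inv {_} _.
Arguments one {_}.

Notation "x ⊙ y" := (prod x y) (at level 40, left associativity) : mbe_scope.
Notation "x ^*" := (inv x) (at level 2, left associativity, format "x ^*")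
  : mbe_scope.
Notation "1" := one : mbe_scope.

Open Scope mbe_scope.

(* The operations written ∧_m^M and ∨_m^M; neither is commutative in general. *)
Definition meetM {X : inv_left_mBE} (x y : X) : X := (x^* ⊙ y)^* ⊙ y.
Definition joinM {X : inv_left_mBE} (x y : X) : X := (meetM x^* y^*)^*.

Definition quantum_MV (X : inv_left_mBE) : Prop :=
  forall x y z : X,
    x ⊙ joinM (joinM x^* y) (joinM z x^*) = joinM (x ⊙ y) (x ⊙ z).

Definition arrow {X : inv_left_mBE} (x y : X) : X := (x ⊙ y^*)^*.
Definition leM {X : inv_left_mBE} (x y : X) : Prop := arrow x y = 1.

Record quantum_B (X : Type) (le : relation X) (imp sqimp : X -> X -> X) : Prop :=
  QuantumB {
    qB_order : order X le;
    qB_imp : forall x y z, le (imp y z) (imp (imp x y) (imp x z));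
    qB_sqimp : forall x y z,
      le (sqimp y z) (sqimp (sqimp x y) (sqimp x z));
    qB_mono : forall x y z, le y z -> le (imp x y) (imp x z);
    qB_adj : forall x y z, le x (imp y z) <-> le y (sqimp x z)
  }.

(* The structure (X, ≤, →): the second implication is the one that coincides
   pointwise with →. *)
Definition comm_quantum_B (X : Type) (le : relation X) (imp : X -> X -> X) :
    Prop :=
  exists sqimp : X -> X -> X,
    quantum_B X le imp sqimp /\ forall x y, imp x y = sqimp x y.

(* Main.v *)
(** The diamond [{0, a, b, 1}] with [a^* = a], [b^* = b], in which the product
    of any two elements other than [1] is [0], is a quantum-MV algebra.  Since
    [a ⊙ b^* = 0 = b ⊙ a^*], both [a ≤ b] and [b ≤ a] hold, so [≤] is not
    antisymmetric. *)
From Stdlib Require Import Relations.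
Require Import Defs.

Inductive diamond : Type := bot | atom_a | atom_b | top.

Definition diamond_prod (x y : diamond) : diamond :=
  match x, y with
  | top, z | z, top => z
  | _, _ => bot
  end.

Definition diamond_inv (x : diamond) : diamond :=
  match x with
  | bot => top
  | top => bot
  | z => z
  end.

Definition diamond_mBE : inv_left_mBE.
Proof.
  refine (InvLeftMBE diamond diamond_prod diamond_inv top _ _ _ _ _ _ _);
    repeat intros []; reflexivity.
(* Kept transparent so that [prod], [inv] and [one] compute on the four elements in the proofs
   below. *)
Defined.

(** A finite check: in each of the 64 cases for [x], [y], [z] both sides compute to the same
    element. *)
Lemma diamond_quantum_MV : quantum_MV diamond_mBE.
Proof. repeat intros []; reflexivity. Qed.

Lemma diamond_leM_not_antisym : ~ antisymmetric diamond_mBE leM.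
Proof.
  intros antisym.
  (* Both inequalities reduce to [top = top], hence [eq_refl]. *)
  discriminate (antisym atom_a atom_b eq_refl eq_refl).
Qed.

Theorem corollary5p2 :
  exists X : inv_left_mBE,
    quantum_MV X /\ ~ comm_quantum_B X (@leM X) (@arrow X).
Proof.
  exists diamond_mBE; split.
  - exact diamond_quantum_MV.
  (* Whatever [sqimp] is, [qB_order] makes [leM] antisymmetric. *)
  - intros [sqimp [[[_ _ antisym] _ _ _ _] _]].
    exact (diamond_leM_not_antisym antisym).
Qed.
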